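(* Let $R$ be a ring and let $\theta\le\kappa$ be uncountable cardinals with $\theta$ regular. Let $C,M$ be right $R$-modules and let $(M_\alpha,f_{\beta\alpha}\colon M_\alpha\to M_\beta\mid\alpha<\beta\le\theta)$ be a $\theta$-continuous well-ordered directed system of modules such that $M=M_\theta=\varinjlim_{\alpha<\theta}M_\alpha$ and $M_\alpha$ is $<\theta$-generated for every $\alpha<\theta$. Suppose that $\operatorname{Ext}^1_R(M_\alpha,C^{(\kappa)})=0$ for all $\alpha<\theta$. Then the following conditions are equivalent: (1) $\operatorname{Ext}^1_R(M,C^{(\kappa)})=0$. (2) There is a closed unbounded subset $X\subseteq\theta$ such that $f_{\beta\alpha}$ is $C^{(\kappa)}$-injective for all $\alpha,\beta\in X$ with $\alpha<\beta$.
   Context: $R$ is an associative unital ring; modules are right $R$-modules. $C^{(\kappa)}$ is the direct sum of $\kappa$ copies of $C$. A homomorphism $f\colon A\to B$ is $D$-injective, for a module $D$, if $\operatorname{Hom}_R(f,D)\colon\operatorname{Hom}_R(B,D)\to\operatorname{Hom}_R(A,D)$ is surjective. A directed system $(M_i,f_{ji}\mid i<j\in I)$ is $\theta$-continuous (for $\theta$ regular uncountable) if $(I,\le)$ has suprema of all chains of length $<\theta$ and, for any such chain $J\subseteq I$, $M_{\sup J}=\varinjlim_{j\in J}M_j$. *)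

(* Defs.v *)
From HB Require Import structures.
From mathcomp Require Import all_boot all_order all_algebra.
From mathcomp Require Import boolp classical_sets functions cardinality wochoice.

Set Implicit Arguments.
Unset Strict Implicit.
Unset Printing Implicit Defensive.

Import Order.TTheory GRing.Theory.
Local Open Scope classical_set_scope.
Local Open Scope card_scope.
Local Open Scope ring_scope.

(* Everything below is stated for left modules over an arbitrary ring; right  *)
(* R-modules are left modules over the converse ring R^c.                     *)

Section DirectSum.
Variables (R : pzRingType) (K : Type) (C : lmodType R).

Definition finite_support : pred (K -> C) :=
  fun f => `[< finite_set [set k | f k != 0] >].

Lemma finite_support_submod_closed : submod_closed finite_support.
Proof.
split=> [|a f g /asboolP fin_f /asboolP fin_g]; apply/asboolP.
  rewrite (_ : [set _ | _] = set0) //.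
  by apply/seteqP; split=> k //=; rewrite eqxx.
apply: (@sub_finite_set _ _ ([set k | f k != 0] `|` [set k | g k != 0])).
  move=> k /= nz; case: (eqVneq (f k) 0) => [fk0|]; last by left.
  right; apply: contra_neq nz => gk0.
  change (a *: f k + g k = 0); by rewrite fk0 gk0 scaler0 addr0.
by rewrite finite_setU.
Qed.

HB.instance Definition _ := GRing.isSubmodClosed.Build R (K -> C)
  finite_support finite_support_submod_closed.

(* The direct sum C^(K) of copies of C indexed by K. *)
Record dirsum := DirSum { dirsum_fun :> K -> C; _ : finite_support dirsum_fun }.

HB.instance Definition _ := [isSub for dirsum_fun].
HB.instance Definition _ := [Choice of dirsum by <:].
HB.instance Definition _ := [SubChoice_isSubLmodule of dirsum by <:].

End DirectSum.

Section Modules.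
Variable R : pzRingType.
Implicit Types A B D P N : lmodType R.

Definition hom_injective D A B (f : {linear A -> B}) : Prop :=
  forall g : {linear A -> D}, exists h : {linear B -> D},
    forall x, h (f x) = g x.

Definition projective P : Prop :=
  forall A B (p : {linear A -> B}) (f : {linear P -> B}),
    (forall b, exists a, p a = b) ->
    exists g : {linear P -> A}, forall x, p (g x) = f x.

Definition exact_at A B D (f : {linear A -> B}) (g : {linear B -> D}) : Prop :=
  range f = [set y | g y = 0].

(* The part P2 -> P1 -> P0 -> A -> 0 of a projective resolution of A that     *)
(* determines Ext^1(A, -); it always extends to a full resolution.            *)
Record proj_resolution2 A := ProjResolution2 {
  res0 : lmodType R;
  res1 : lmodType R;
  res2 : lmodType R;
  res_aug : {linear res0 -> A};
  res_d1 : {linear res1 -> res0};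
  res_d2 : {linear res2 -> res1};
  _ : [/\ projective res0, projective res1 & projective res2];
  _ : forall a, exists x, res_aug x = a;
  _ : exact_at res_d1 res_aug;
  _ : exact_at res_d2 res_d1 }.

Arguments res_d1 {A} _.
Arguments res_d2 {A} _.

Definition cocycle1 A (P : proj_resolution2 A) B : set {linear res1 P -> B} :=
  [set phi | forall x, phi (res_d2 P x) = 0].

Definition coboundary1 A (P : proj_resolution2 A) B :
    set {linear res1 P -> B} :=
  [set phi | exists psi : {linear res0 P -> B},
               forall x, phi x = psi (res_d1 P x)].

(* Ext^1(A, B) = H^1(Hom(P, B)) for a projective resolution P of A, and up to *)
(* isomorphism it does not depend on P.                                       *)
Definition Ext1_eq0 A B : Prop :=
  forall P : proj_resolution2 A, @cocycle1 A P B `<=` @coboundary1 A P B.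

End Modules.

Definition card_lt T U (A : set T) (B : set U) : Prop :=
  A #<= B /\ ~ (B #<= A).

Section Ordinals.
Variables (d : Order.disp_t) (I : orderType d).
Implicit Types (a b s theta : I) (J X : set I).

(* In a well-ordered type, an element plays the role of the ordinal below it. *)
Definition below theta : set I := [set a | (a < theta)%O].

Definition cofinal_in theta J : Prop :=
  J `<=` below theta /\
  forall a, below theta a -> exists2 b, J b & (a <= b)%O.

Definition uncountable_regular_cardinal theta : Prop :=
  [/\ ~ countable (below theta),
      forall a, (a < theta)%O -> card_lt (below a) (below theta)
    & forall J, cofinal_in theta J -> J #= below theta].

Definition club theta X : Prop :=
  cofinal_in theta X /\
  forall J s, J `<=` X -> J !=set0 -> (s < theta)%O -> supremums J s -> X s.

End Ordinals.

Definition lt_generated (R : pzRingType) (A : lmodType R) (U : Type)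
    (T : set U) : Prop :=
  exists2 S : set A, card_lt S T &
    forall x, exists (n : nat) (a : 'I_n -> R) (s : 'I_n -> A),
      (forall i, S (s i)) /\ x = \sum_(i < n) a i *: s i.

Record directed_system (R : pzRingType) (d : Order.disp_t) (I : orderType d) :=
  DirectedSystem {
    ds_mod :> I -> lmodType R;
    ds_map : forall i j, (i <= j)%O -> {linear ds_mod i -> ds_mod j};
    _ : forall i (ii : (i <= i)%O) x, ds_map ii x = x;
    _ : forall i j k (ij : (i <= j)%O) (jk : (j <= k)%O) (ik : (i <= k)%O) x,
          ds_map jk (ds_map ij x) = ds_map ik x }.

Section Continuity.
Variables (R : pzRingType) (d : Order.disp_t) (I : orderType d).
Variable M : directed_system R I.

(* M s, with the structural maps of M, is the direct limit of the M j, j in J; *)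
(* the components of g at indices outside J play no role.                      *)
Definition is_direct_limit (J : set I) (s : I) : Prop :=
  ubound J s /\
  forall (N : lmodType R) (g : forall j, {linear M j -> N}),
    (forall i j (ij : (i <= j)%O) x, J i -> J j ->
       g j (ds_map M ij x) = g i x) ->
    let factors (h : {linear M s -> N}) :=
      forall j (js : (j <= s)%O) x, J j -> h (ds_map M js x) = g j x in
    (exists h, factors h) /\
    (forall h h', factors h -> factors h' -> forall x, h x = h' x).

(* In a well-ordered I every subset is a well-ordered chain, and since theta  *)
(* is a cardinal, "of length < theta" means "of cardinality < theta". Chains  *)
(* are nonempty, so nothing is imposed on the module at the least index.      *)
Definition continuous_system (theta : I) : Prop :=
  forall J : set I, J !=set0 -> card_lt J (below theta) ->
    exists2 s, supremums J s & is_direct_limit J s.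

End Continuity.

(* Main.v *)
Require Import Defs.
From mathcomp Require Import all_boot all_order all_algebra.
From mathcomp Require Import boolp classical_sets functions cardinality wochoice.
From mathcomp Require Import generic_quotient ring_quotient fsbigop.
From HB Require Import structures.

Set Implicit Arguments.
Unset Strict Implicit.
Unset Printing Implicit Defensive.

Import Order.TTheory GRing.Theory.
Local Open Scope classical_set_scope.
Local Open Scope card_scope.
Local Open Scope ring_scope.

(* Write D for C^(K).

   From (2) to (1): an extension of M theta by D is split by lifting the maps
   M a -> M theta to it compatibly, by recursion along the club. At a successor,
   Ext^1(M b, D) = 0 yields some lift, which D-injectivity corrects so that it
   extends the previous one; limits are handled by continuity.

   From (1) to (2): fix an injection e of theta into K. If f_{ba} is not
   D-injective for some b, choose b and a map g_a : M a -> D that does not factor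
   through f_{ba}. As M a is generated by fewer than theta elements, g_a may be
   taken to have its values supported in e([a, c)) for some c < theta. Along the
   club of points closed under a |-> b, c, build by recursion a cocycle
   h_{ba} : M a -> D, i.e. h_{ca} = h_{cb} f_{ba} + h_{ba}, such that h_{ba} has
   no coordinate in e([b, theta)) and h_{ba} = g_a when b is the successor of a
   in the club. The vanishing of Ext^1(M b, D) carries the recursion through the
   limit stages, and that of Ext^1(M theta, D) carries it through theta itself.
   By regularity, for club many a the map h_{theta a} has no coordinate in
   e([a, theta)). Projecting h_{theta a} = h_{theta b} f_{ba} + g_a onto these
   coordinates then shows that g_a factors through f_{ba}, so that for such a
   every f_{ba} is D-injective. *)

(** * Modules and Ext *)

Section LinearAlgebra.
Variable R : pzRingType.
Implicit Types A B D E F : lmodType R.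

Lemma linear_bundle A B (f : A -> B) :
  linear f -> exists g : {linear A -> B}, forall x, g x = f x.
Proof.
move=> lf; pose m := GRing.isLinear.Build R A B *:%R f lf.
pose g : {linear A -> B} := HB.pack f m.
by exists g.
Qed.

Definition surjective A B (f : A -> B) : Prop := forall b, exists a, f a = b.

Lemma factor_through_surjection F A E (q : {linear F -> A}) (l : {linear F -> E}) :
    surjective q -> (forall x, q x = 0 -> l x = 0) ->
  exists s : {linear A -> E}, forall x, s (q x) = l x.
Proof.
move=> /choice[r rK] ker_ql.
have lE x y : q x = q y -> l x = l y.
  move=> qxy; apply/eqP; rewrite -subr_eq0 -linearB; apply/eqP/ker_ql.
  by rewrite linearB qxy subrr.
have [a x y|s sE] := @linear_bundle A E (l \o r).
  by rewrite /= -linearP; apply: lE; rewrite linearP !rK.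
by exists s => x; rewrite sE; apply: lE; rewrite rK.
Qed.

Definition submodule E (W : set E) : Prop :=
  W 0 /\ forall a x y, W x -> W y -> W (a *: x + y).

(** Generation by the [e x] is stated as an induction principle, so that an identity of linear maps
    on [F] is checked on the basis. *)
Definition free_on (X : choiceType) F (e : X -> F) : Prop :=
  (forall A (v : X -> A), exists l : {linear F -> A}, forall x, l (e x) = v x) /\
  (forall W : set F, submodule W -> (forall x, W (e x)) -> forall y, W y).

(** The quotient of the additive group carries the scalar multiplication computed on
    representatives. *)
Lemma quotient_module E (W : set E) : submodule W ->
  exists (Q : lmodType R) (q : {linear E -> Q}),
    surjective q /\ forall x, q x = 0 <-> W x.
Proof.
move=> [W0 Wlin]; pose P : {pred E} := fun x => `[< W x >].
have Pclosed : submod_closed P.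
  split=> [|a x y /asboolP Wx /asboolP Wy]; apply/asboolP => //; exact: Wlin.
pose mS := GRing.isSubmodClosed.Build R E P Pclosed.
pose Z : zmodClosed E := HB.pack P mS.
pose T := Quotient.quot Z.
have piE x y : (\pi_T x = \pi_T y)%qT <-> W (x - y).
  split=> [/eqP|Wxy]; first by rewrite -Quotient.idealrBE => /asboolP.
  by apply/eqP; rewrite -Quotient.idealrBE; apply/asboolP.
have [sc scE] : exists sc : R -> T -> T,
    forall a x, sc a (\pi_T x)%qT = (\pi_T (a *: x))%qT.
  exists (fun a x => \pi_T (a *: repr x))%qT => a x.
  apply/piE; rewrite -scalerBr -[_ *: _]addr0; apply: Wlin => //.
  by apply/piE; rewrite reprK.
have pi_surj (x : T) : exists y, x = (\pi_T y)%qT.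
  by exists (repr x); rewrite reprK.
have scA a b x : sc a (sc b x) = sc (a * b) x.
  by have [y ->] := pi_surj x; rewrite !scE scalerA.
have sc1 : left_id 1 sc.
  by move=> x; have [y ->] := pi_surj x; rewrite scE scale1r.
have scDr : right_distributive sc +%R.
  move=> a x x'; have [y ->] := pi_surj x; have [y' ->] := pi_surj x'.
  by rewrite -raddfD !scE scalerDr raddfD.
have scDl x : {morph sc^~ x : a b / a + b}.
  by move=> a b; have [y ->] := pi_surj x; rewrite !scE scalerDl raddfD.
pose mQ := GRing.Zmodule_isLmodule.Build R T scA sc1 scDr scDl.
pose Q : lmodType R := HB.pack T mQ.
have [a x y|q qE] := @linear_bundle E Q (fun x => (\pi_T x)%qT).
  by rewrite raddfD; congr (_ + _); exact: (esym (scE a x)).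
exists Q, q; split=> [y|x]; first by exists (repr (y : T)); rewrite qE reprK.
by rewrite qE -{2}[x]subr0 -piE raddf0.
Qed.

End LinearAlgebra.

(** * Direct sums and free modules *)

Section DirectSumTheory.
Variables (R : pzRingType) (K : Type) (C : lmodType R).
Implicit Types y z : dirsum K C.

Lemma dirsumD y z k : (y + z : dirsum K C) k = y k + z k.
Proof. by []. Qed.

Lemma dirsumZ a y k : (a *: y : dirsum K C) k = a *: y k.
Proof. by []. Qed.

Lemma dirsum_ext y z : (forall k, y k = z k) -> y = z.
Proof. by move=> yz; apply/val_inj/funext. Qed.

Lemma dirsum_finite y : finite_set [set k | y k != 0].
Proof. by case: y => f /= /asboolP. Qed.

End DirectSumTheory.

Lemma dirsum_seq_support (R : pzRingType) (K : choiceType) (C : lmodType R)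
    (y z : dirsum K C) :
  exists2 s : seq K, uniq s & forall k, k \notin s -> y k = 0 /\ z k = 0.
Proof.
have /finite_seqP[s sE] :
    finite_set ([set k | y k != 0] `|` [set k | z k != 0]).
  by rewrite finite_setU; split; apply: dirsum_finite.
exists (undup s); rewrite ?undup_uniq// => k; rewrite mem_undup => /negP ks.
split; apply: contra_notP ks => /eqP nz; change ([set` s] k); rewrite -sE.
- by left.
- by right.
Qed.

(** Here [r k] is the coordinate that the new coordinate [k] is read from, with [None] for zero;
    injectivity of [r] keeps supports finite. Erasing coordinates and moving them are both
    instances. *)
Lemma dirsum_reindex (R : pzRingType) (K : Type) (C : lmodType R)
    (r : K -> option K) :
    (forall k k' k0, r k = Some k0 -> r k' = Some k0 -> k = k') ->
  exists l : {linear dirsum K C -> dirsum K C},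
    forall y k, l y k = if r k is Some k0 then y k0 else 0.
Proof.
move=> r_inj.
have fin (y : dirsum K C) :
    Defs.finite_support (fun k => if r k is Some k0 then y k0 else 0).
  apply/asboolP.
  apply: (@sub_finite_set _ _ (r @^-1` (some @` [set k | y k != 0]))).
    by move=> k /=; case: (r k) => [k0 y0|]; [exists k0 | rewrite eqxx].
  apply: finite_preimage; last exact/finite_image/dirsum_finite.
  move=> k k'; rewrite !inE => -[k0 _ rk0] _ rkk'.
  by apply: (r_inj _ _ k0); rewrite -?rkk'.
have [a y z|l lE] := @linear_bundle _ (dirsum K C) (dirsum K C)
    (fun y => DirSum (fin y)).
  apply: dirsum_ext => k; rewrite dirsumD dirsumZ /=.
  by case: (r k) => [k0|]; rewrite ?scaler0 ?addr0.
by exists l => y k; rewrite lE.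
Qed.

(** The model is the direct sum of copies of [R] indexed by [X], with the indicator functions as
    basis. *)
Lemma free_module (R : pzRingType) (X : choiceType) :
  exists (F : lmodType R) (e : X -> F), free_on e.
Proof.
have e_fin x : Defs.finite_support (fun k : X => (k == x)%:R : R^o).
  apply/asboolP; apply: (@sub_finite_set _ _ [set x]) => // k /=.
  by case: (eqVneq k x) => //=; rewrite eqxx.
pose e x : dirsum X R^o := DirSum (e_fin x).
have sumE (A : lmodType R) (v : X -> A) (y : dirsum X R^o) (s : seq X) :
    uniq s -> (forall k, k \notin s -> y k = 0) ->
    \sum_(k \in [set: X]) (y k : R) *: v k = \sum_(k <- s) (y k : R) *: v k.
  move=> us sy; rewrite (fsbigE s) //.
    by apply: eq_bigl => k; rewrite in_setT.
  by move=> k _ /sy ->; rewrite scale0r.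
exists (dirsum X R^o), e; split=> [A v|W [W0 Wlin] We y].
  have [a y z|l lE] := @linear_bundle _ (dirsum X R^o) A
      (fun y => \sum_(k \in [set: X]) (y k : R) *: v k).
    have [s us sP] := dirsum_seq_support y z.
    have yzE k : (a *: y + z) k = a * (y k : R) + (z k : R) :> R by [].
    rewrite !(sumE _ _ _ s) //; try by move=> k /sP[].
      rewrite scaler_sumr -big_split; apply: eq_bigr => k _ /=.
      by rewrite [X in X *: v k](yzE k) scalerDl scalerA.
    by move=> k /sP[yk zk]; rewrite (yzE k) yk zk mulr0 addr0.
  exists l => x; rewrite lE (sumE _ _ _ [:: x]) //.
    by rewrite big_seq1 /= eqxx scale1r.
  by move=> k; rewrite inE /= => /negPf ->.
have [s us sP] := dirsum_seq_support y y.
have -> : y = \sum_(k <- s) (y k : R) *: e k.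
  apply: dirsum_ext => k.
  have -> (r : seq X) : (\sum_(i <- r) (y i : R) *: e i) k =
      \sum_(i <- r) y i * (k == i)%:R.
    by elim: r => [|i r IH]; rewrite ?big_nil // !big_cons dirsumD IH.
  have [ks|ks] := boolP (k \in s); last first.
    rewrite (sP _ ks).1 big_seq big1 // => i si.
    by case: eqVneq ks => [->|_ _]; rewrite ?si // mulr0.
  rewrite (bigD1_seq k) //= eqxx mulr1 big1 ?addr0 // => i ik.
  by rewrite eq_sym (negPf ik) mulr0.
elim: s {us sP} => [|k s IH]; first by rewrite big_nil.
by rewrite big_cons; apply: Wlin.
Qed.

(** * Vanishing of Ext and splitting of extensions *)

Section Ext.
Variable R : pzRingType.
Implicit Types A B D E F N : lmodType R.

Lemma exact_atP A B D (f : {linear A -> B}) (g : {linear B -> D}) :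
  exact_at f g <->
  (forall x, g (f x) = 0) /\ (forall y, g y = 0 -> exists x, f x = y).
Proof.
split=> [ex|[gf0 ker_g]].
  split=> [x|y gy0]; first by have : range f (f x) by []; rewrite ex.
  have : [set y | g y = 0] y by []; rewrite -ex => -[x _ <-]; by exists x.
apply/seteqP; split=> [_ [x _ <-]|y /= /ker_g[x <-]]; first exact: gf0.
by exists x.
Qed.

Lemma submodule_ker A B (f : {linear A -> B}) : submodule [set x | f x = 0].
Proof.
split=> [|a x y /= fx fy]; first exact: linear0.
by rewrite linearP fx fy scaler0 addr0.
Qed.

Lemma submodule_eq A B (f g : {linear A -> B}) : submodule [set x | f x = g x].
Proof.
by split=> [|a x y /= fgx fgy]; rewrite /= ?linear0 // !linearP fgx fgy.
Qed.

Lemma free_projective (X : choiceType) F (e : X -> F) :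
  free_on e -> projective F.
Proof.
move=> [lift ind] A B p f p_surj.
have [r rE] := choice (fun x => p_surj (f (e x))).
have [l lE] := lift A r; exists l.
have Wsub : submodule [set x | p (l x) = f x] := submodule_eq (p \o l) f.
by apply: (ind _ Wsub) => x /=; rewrite lE rE.
Qed.

(** The free module on all of [A] covers the kernel once the basis elements outside it are sent to
    zero; the kernel itself is never made into a module. *)
Lemma kernel_cover A B (f : {linear A -> B}) :
  exists (P : lmodType R) (u : {linear P -> A}), projective P /\ exact_at u f.
Proof.
have [P [e e_free]] := free_module R A; have [lift ind] := e_free.
have [u uE] := lift A (fun x => if f x == 0 then x else 0).
exists P, u; split; first exact: free_projective e_free.
apply/seteqP; split=> [_ [y _ <-]|x /= fx0]; last first.
  by exists (e x) => //; rewrite uE fx0 eqxx.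
have Wsub : submodule [set y | f (u y) = 0] := submodule_ker (f \o u).
apply: (ind _ Wsub) => x /=; rewrite uE.
by case: eqP => // _; rewrite linear0.
Qed.

(** Covering the kernel of [q] gives a resolution that starts with [F], and [phi] pulled back to it
    is a cocycle. A cochain bounding it is the extension. As [phi] is a bare function, linear on the
    kernel only, it can be produced by choice. *)
Lemma Ext1_eq0_extend A B F (q : {linear F -> A}) (phi : F -> B) :
    Ext1_eq0 A B -> projective F -> surjective q ->
    (forall a x y, q x = 0 -> q y = 0 -> phi (a *: x + y) = a *: phi x + phi y) ->
  exists psi : {linear F -> B}, forall x, q x = 0 -> psi x = phi x.
Proof.
move=> ext F_proj q_surj phi_lin.
have [P1 [u1 [P1_proj ex1]]] := kernel_cover q.
have [P2 [u2 [P2_proj ex2]]] := kernel_cover u1.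
have /exact_atP[qu1 ker_q] := ex1; have /exact_atP[u1u2 _] := ex2.
have phi0 : phi 0 = 0.
  have := phi_lin 1 0 0 (linear0 q) (linear0 q).
  by rewrite !scale1r addr0 -{1}[phi 0]addr0 => /addrI.
pose P := ProjResolution2 (And3 F_proj P1_proj P2_proj) q_surj ex1 ex2.
have [a x y|phi1 phi1E] := @linear_bundle _ P1 B (phi \o u1).
  by rewrite /= linearP phi_lin.
have [x|psi psiE] := ext P phi1; first by rewrite /= phi1E /= u1u2.
exists psi => x /ker_q[y <-].
by have /= <- := psiE y; rewrite phi1E.
Qed.

(** On a free cover [F] of [A] a lift [l] exists. Restricted to the kernel of [q] it takes values in
    [j B]; subtracting an extension of this restriction to [F] makes the lift descend to [A]. *)
Lemma Ext1_eq0_lift A A' B E (j : {linear B -> E}) (p : {linear E -> A'})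
    (f : {linear A -> A'}) :
    Ext1_eq0 A B -> surjective p -> injective j -> exact_at j p ->
  exists s : {linear A -> E}, forall x, p (s x) = f x.
Proof.
move=> ext p_surj j_inj /exact_atP[pj ker_p].
have [F [e e_free]] := free_module R A; have [lift ind] := e_free.
have F_proj := free_projective e_free.
have [q qE] := lift A id.
have q_surj : surjective q by move=> a; exists (e a).
have [l lE] := F_proj _ _ p (f \o q) p_surj.
have /choice[phi phiE] (x : F) : exists b, q x = 0 -> j b = l x.
  have [qx0|/eqP qx0] := eqVneq (q x) 0; last by exists 0.
  have [|b jb] := ker_p (l x); first by rewrite lE /= qx0 linear0.
  by exists b.
have [a x y qx qy|psi psiE] := Ext1_eq0_extend ext F_proj q_surj (phi := phi).
  by apply: j_inj; rewrite linearP !phiE ?linearP // qx qy scaler0 addr0.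
have [a x y|l' l'E] := @linear_bundle _ F E (fun x => l x - j (psi x)).
  by rewrite (linearP l) (linearP psi) (linearP j) opprD addrACA scalerBr.
have [x qx|s sE] := factor_through_surjection q_surj (l := l').
  by rewrite l'E psiE // phiE // subrr.
exists s => a; have [x <-] := q_surj a.
by rewrite sE l'E linearB /= pj subr0 lE.
Qed.

(* The pushout of [0 -> ker -> P0 -> A -> 0] along a cocycle is an extension of
   [A] by [B]; a section of it turns the cocycle into a coboundary. *)
Lemma Ext1_eq0_split A B :
    (forall E (j : {linear B -> E}) (p : {linear E -> A}),
       surjective p -> injective j -> exact_at j p ->
       exists s : {linear A -> E}, forall x, p (s x) = x) ->
  Ext1_eq0 A B.
Proof.
move=> split_ext [P0 P1 P2 aug d1 d2 proj aug_surj ex1 ex2] phi /= phi0.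
have /exact_atP[augd1 ker_aug] := ex1; have /exact_atP[_ ker_d1] := ex2.
have ker_phi x : d1 x = 0 -> phi x = 0 by move=> /ker_d1[y <-]; apply: phi0.
pose W : set (P0 * B)%type := [set z | exists x, z = (d1 x, - phi x)].
have Wsub : submodule W.
  split=> [|a _ _ [x ->] [y ->]].
    by exists 0; rewrite (linear0 d1) (linear0 phi) oppr0.
  by exists (a *: x + y); rewrite (linearP d1) (linearP phi) opprD -scalerN.
have [E [q [q_surj q0]]] := quotient_module Wsub.
have [a x y|j jE] := @linear_bundle _ B E (fun b => q (0, b)).
  by rewrite -linearP /=; congr (q (_, _)); rewrite /= scaler0 addr0.
have [a x y|pr prE] := @linear_bundle _ (P0 * B)%type A (fun z => aug z.1).
  by rewrite linearP.
have [x /q0[y ->]|p pE] := factor_through_surjection q_surj (l := pr).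
  by rewrite prE augd1.
have p_surj : surjective p.
  by move=> a; have [x <-] := aug_surj a; exists (q (x, 0)); rewrite pE prE.
have j_inj : injective j.
  move=> b b' /eqP; rewrite -subr_eq0 -linearB jE => /eqP/q0[x [d1x bx]].
  by apply/eqP; rewrite -subr_eq0 bx ker_phi ?oppr0 // -d1x.
have ex : exact_at j p.
  apply/exact_atP; split=> [b|z]; first by rewrite jE pE prE linear0.
  have [[x b] <-] := q_surj z; rewrite pE prE /= => augx.
  have [y yx] := ker_aug _ augx.
  exists (b + phi y); rewrite jE; apply/eqP; rewrite -subr_eq0 -linearB.
  apply/eqP/q0; exists (- y); rewrite !linearN opprK.
  by congr (_, _); rewrite /= ?sub0r ?yx // addrAC subrr add0r.
have [s sE] := split_ext _ _ _ p_surj j_inj ex.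
have /exact_atP[_ ker_p] := ex.
(* Both terms lie over [aug x], so their difference comes from [B]; at [x = d1 y] it is
   [q (d1 y, 0) = j (phi y)]. *)
have /choice[psi psiE] (x : P0) : exists b, j b = q (x, 0) - s (aug x).
  by apply: ker_p; rewrite linearB /= sE pE prE subrr.
have [a x y|psi' psi'E] := @linear_bundle _ P0 B psi.
  apply: j_inj; rewrite linearP !psiE [aug _]linearP linearP /= scalerBr.
  rewrite addrACA -opprD; congr (_ - _); rewrite -linearP /=.
  by congr (q (_, _)); rewrite /= scaler0 addr0.
exists psi' => x; apply: j_inj; rewrite psi'E psiE augd1 linear0 subr0 jE.
apply/eqP; rewrite -subr_eq0 -linearB; apply/eqP/q0; exists (- x).
by rewrite !linearN opprK; congr (_, _); rewrite /= ?sub0r // subr0.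
Qed.

End Ext.

(** * Well-orders and regular cardinals *)

(** Nonemptiness of [A] forces a point in [B], which is what a total function on [T] requires
    outside [A]. *)
Lemma inj_card_leP T U (A : set T) (B : set U) : A !=set0 ->
  A #<= B <->
  exists2 f : T -> U, (forall x, A x -> B (f x)) & {in A &, injective f}.
Proof.
move=> A0; split=> [|[f fB f_inj]]; last first.
  by have /injfunPex[g] : exists2 f : T -> U, set_fun A B f & set_inj A f;
    [exists f | exact: inj_card_le].
case: (pselect (exists u, B u)) => [[u _] AB|noB]; last first.
  rewrite (_ : B = set0) ?card_le0 => [/eqP A00|].
    by have [x] := A0; rewrite A00.
  by apply/seteqP; split=> // y By; case: noB; exists y.
pose mU := isPointed.Build U u.
pose U' : pointedType := HB.pack U (gen_eqMixin U) (gen_choiceMixin U) mU.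
have /(@pcard_leP T U')[f] := AB.
by exists f => [x|]; [exact: funS | exact: inj].
Qed.

Section WellOrder.
Variables (d : Order.disp_t) (I : orderType d).
Hypothesis I_wo : well_order (<=%O : rel I).
Implicit Types (a b s theta : I) (J X : set I).

Lemma wo_min J : J !=set0 -> exists z, J z /\ forall x, J x -> (z <= x)%O.
Proof.
move=> [x Jx]; have [|z [[zJ zmin] _]] := I_wo (A := mem J).
  by exists x; rewrite inE.
exists z; split; first by move: zJ; rewrite inE.
by move=> y Jy; apply: zmin; rewrite inE.
Qed.

Lemma wo_wf : well_founded (fun a b : I => (a < b)%O).
Proof.
move=> a; apply: contrapT => nacc.
have [z [zacc zmin]] := @wo_min [set x | ~ Acc (fun a b : I => (a < b)%O) x]
  (ex_intro _ a nacc).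
apply: zacc; constructor=> y yz; apply: contrapT => /zmin.
by rewrite leNgt yz.
Qed.

Lemma wo_ind (P : I -> Prop) :
  (forall b, (forall a, (a < b)%O -> P a) -> P b) -> forall b, P b.
Proof. by move=> IH b; elim: (wo_wf b) => x _; apply: IH. Qed.

Lemma wo_sup J : ubound J !=set0 -> exists s, supremums J s.
Proof. by move=> /wo_min[s [Js smin]]; exists s; split. Qed.

(** [Phi b h v] reads: [v] is admissible at stage [b] after the values of [h] below [b]. The second
    hypothesis says that no other values of [h] matter. *)
Lemma transfinite_choice (T : I -> Type)
    (Phi : forall b, (forall a, T a) -> T b -> Prop) :
    (forall a, inhabited (T a)) ->
    (forall b h h' v, (forall a, (a < b)%O -> h a = h' a) ->
       Phi b h v -> Phi b h' v) ->
    (forall b h, (forall a, (a < b)%O -> Phi a h (h a)) -> exists v, Phi b h v) ->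
  exists h, forall b, Phi b h (h b).
Proof.
move=> T_inh Phi_ext step.
have [dflt] : inhabited (forall a, T a).
  have h a : {x : T a | True} by apply: cid; have [x] := T_inh a; exists x.
  by constructor=> a; have [x] := h a.
(* An admissible value if there is one, a default otherwise: the recursion is defined first, and
   admissibility is proved afterwards by induction. *)
have pick b h : {v : T b | forall w, Phi b h w -> Phi b h v}.
  apply: cid; have [[v vP]|noP] := pselect (exists v, Phi b h v).
    by exists v.
  by exists (dflt b) => w Pw; case: noP; exists w.
pose restr b (prev : forall a, (a < b)%O -> T a) a : T a :=
  if pselect (a < b)%O is left ab then prev a ab else dflt a.
pose h := Fix wo_wf T (fun b prev => sval (pick b (restr b prev))).
have hE b : h b = sval (pick b (restr b (fun a _ => h a))).
  rewrite {1}/h Fix_eq // => c f g fg.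
  suff -> : f = g by [].
  by apply: functional_extensionality_dep => a; apply: functional_extensionality_dep.
exists h; elim/wo_ind => b IH; rewrite hE.
have [v hv] := step b h IH.
have restrE a : (a < b)%O -> restr b (fun a _ => h a) a = h a.
  by rewrite /restr; case: pselect.
apply: (Phi_ext _ _ _ _ restrE); apply: (svalP (pick b _)).
by apply: Phi_ext hv => a /restrE.
Qed.

(** * Bounded sets, closed unbounded sets and cardinalities below [theta] *)

Section Regular.
Variable theta : I.
Hypothesis theta_reg : uncountable_regular_cardinal theta.

Lemma below_neq0 : below theta !=set0.
Proof.
have [unc _ _] := theta_reg; apply/set0P; apply: contra_notN unc => /eqP ->.
exact: countable0.
Qed.

(** An unbounded [J] would be cofinal, hence of cardinality [theta] by regularity. *)
Lemma regular_bounded J : J `<=` below theta -> ~ (below theta #<= J) ->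
  exists2 b, (b < theta)%O & forall a, J a -> (a < b)%O.
Proof.
move=> Jt; apply: contra_notP => noB; have [_ _ reg] := theta_reg.
have /reg : cofinal_in theta J; last by rewrite card_eq_le => /andP[].
split=> // a at_; apply: contrapT => noJ; apply: noB; exists a => // b Jb.
by rewrite ltNge; apply/negP => ab; apply: noJ; exists b.
Qed.

Lemma not_le_countable T (J : set T) : countable J -> ~ (below theta #<= J).
Proof. by have [unc _ _] := theta_reg => cJ tJ; apply/unc/card_le_trans/cJ. Qed.

Lemma regular_image_bounded (F : I -> I) a : (a < theta)%O ->
    (forall c, (c < theta)%O -> (F c < theta)%O) ->
  exists2 b, (b < theta)%O & forall c, (c < a)%O -> (F c < b)%O.
Proof.
move=> at_ Ft; have [_ small _] := theta_reg.
have [||b bt bP] := @regular_bounded (F @` below a).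
- by move=> _ [c ca <-]; apply/Ft/lt_trans/at_.
- move=> tF; have [_] := small a at_; apply.
  exact: card_le_trans tF (card_image_le _ _).
- by exists b => // c ca; apply: bP; exists c.
Qed.

Lemma regular_seq_bounded (u : nat -> I) : (forall n, (u n < theta)%O) ->
  exists2 b, (b < theta)%O & forall n, (u n < b)%O.
Proof.
move=> ut; have [||b bt bP] := @regular_bounded (range u).
- by move=> _ [n _ <-]; apply: ut.
- by apply: not_le_countable; apply: (card_le_trans (card_image_le _ _)).
- by exists b => // n; apply: bP; exists n.
Qed.

Lemma regular_succ a : (a < theta)%O -> exists2 b, (b < theta)%O & (a < b)%O.
Proof.
by move=> at_; have [b bt /(_ 0)] := @regular_seq_bounded (fun=> a) (fun=> at_);
  exists b.
Qed.

Lemma cofinal_above a : (a < theta)%O ->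
  cofinal_in theta [set x | (a <= x)%O /\ (x < theta)%O].
Proof.
move=> at_; split=> [x []//|b bt].
by case: (leP a b) => ab; [exists b | exists a => //; exact: ltW].
Qed.

(** Closing off: iterate countably often the passage from [x] to a bound of [F] on the ordinals
    below [x]. The supremum of the iterates is closed under [F], and it stays below [theta]. *)
Lemma club_closure_points (F : I -> I) a0 : (a0 < theta)%O ->
    (forall c, (c < theta)%O -> (F c < theta)%O) ->
  club theta [set a | [/\ (a0 <= a)%O, (a < theta)%O &
                          forall c, (c < a)%O -> (F c <= a)%O]].
Proof.
move=> a0t Ft; split; last first.
  move=> J s JX [j Jj] st [sub smin]; split=> // [|c cs].
    by have [a0j _ _] := JX _ Jj; apply: le_trans a0j (sub _ Jj).
  have [k Jk ck] : exists2 k, J k & (c < k)%O.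
    apply: contrapT => noJ; have /smin : ubound J c.
      by move=> k Jk; rewrite leNgt; apply/negP => ck; apply: noJ; exists k.
    by rewrite leNgt cs.
  by have [_ _ kP] := JX _ Jk; apply: le_trans (kP _ ck) (sub _ Jk).
split=> [a []//|a at_].
have /choice[nxt nxtP] (x : I) : exists y, (x < theta)%O ->
    [/\ (y < theta)%O, (x < y)%O & forall c, (c < x)%O -> (F c < y)%O].
  have [xt|] := boolP (x < theta)%O; last by exists x.
  have [y yt yP] := regular_image_bounded xt Ft.
  have [z zt xz] := regular_succ xt.
  exists (Order.max y z) => _; split; rewrite ?gt_max ?yt ?lt_max ?xz ?orbT //.
  by move=> c /yP cy; rewrite lt_max cy.
pose u n := iter n nxt (Order.max a a0).
have ut n : (u n < theta)%O.
  elim: n => [|n IH]; first by rewrite /u /= gt_max; apply/andP.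
  by have [] := nxtP _ IH.
have [c ct uc] := regular_seq_bounded ut.
have u_le_c : ubound (range u) c by move=> _ [n _ <-]; apply/ltW/uc.
have [s [sub smin]] := wo_sup (ex_intro _ c u_le_c).
have st : (s < theta)%O := le_lt_trans (smin _ u_le_c) ct.
have us n : (u n <= s)%O by apply: sub; exists n.
have [a0s as_] : (a0 <= s)%O /\ (a <= s)%O.
  by split; apply: le_trans (us 0); rewrite /u /= le_max lexx ?orbT.
exists s => //; split=> // b bs.
have [n bn] : exists n, (b < u n)%O.
  apply: contrapT => non; have /smin : ubound (range u) b.
    by move=> _ [n _ <-]; rewrite leNgt; apply/negP => ?; apply: non; exists n.
  by rewrite leNgt bs.
have [_ _ /(_ _ bn) Fb] := nxtP _ (ut n).
exact: le_trans (ltW Fb) (us n.+1).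
Qed.

(* Enumerating [T] along [theta] without repetition must stop before [theta]. *)
Lemma not_le_card_below K (T : set K) : ~ (below theta #<= T) ->
  exists2 b, (b < theta)%O & T #<= below b.
Proof.
move=> not_le; have [[k0 Tk0]|T0] := pselect (exists k, T k); last first.
  have [b bt] := below_neq0; exists b => //.
  rewrite (_ : T = set0) ?card_ge0 //.
  by apply/seteqP; split=> // k Tk; case: T0; exists k.
(* Either the value is a new element of [T], or [T] was exhausted before stage [b] and the value is
   arbitrary. *)
have [|b h h' v hh'|b h _|h hP] := @transfinite_choice (fun=> K) (fun b h v =>
    (T v /\ forall a, (a < b)%O -> h a <> v) \/
    (forall k, T k -> exists2 a, (a < b)%O & h a = k)).
- by move=> _; constructor.
- case=> [[Tv hv]|Th]; [left; split=> // a ab; rewrite -hh' //; exact: hv|right].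
  by move=> k /Th[a ab hak]; exists a => //; rewrite -hh'.
- have [?|noT] := pselect (forall k, T k -> exists2 a, (a < b)%O & h a = k).
    by exists k0; right.
  have /existsNP[k nk] := noT.
  exists k; left; apply: contrapT => nTk; apply: nk => Tk.
  apply: contrapT => noa; apply: nTk; split=> // a ab hak.
  by apply: noa; exists a.
apply: contrapT => noB; apply: not_le; apply/inj_card_leP; first exact: below_neq0.
have hT a : (a < theta)%O -> T (h a) /\ forall c, (c < a)%O -> h c <> h a.
  move=> at_; have [//|Th] := hP a; case: noB; exists a => //.
  apply: (card_le_trans (B := h @` below a)); last exact: card_image_le.
  by apply: subset_card_le => k /Th[c ca <-]; exists c.
exists h => [a /hT[]//|a b].
rewrite !inE => /hT[_ ha] /hT[_ hb] hab.
by case: (ltgtP a b) => // [/hb|/ha]; [case | case].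
Qed.

(** Given an injection [j] of [theta] into [T], sort the ordinals [x] by the number that [j x] has
    in a numbering of some [F u] containing it. For a fixed number, [u] determines [x], so each of
    these countably many classes is bounded below [theta]; together they cannot exhaust [theta]. *)
Lemma not_le_countable_union U K (S : set U) (F : U -> set K) (T : set K) :
    ~ (below theta #<= S) -> (forall u, S u -> countable (F u)) ->
    (forall k, T k -> exists2 u, S u & F u k) ->
  ~ (below theta #<= T).
Proof.
move=> not_le F_count T_F /(inj_card_leP _ below_neq0)[j jT j_inj].
have /choice[num numP] (s : U) : exists i : K -> nat, S s -> {in F s &, injective i}.
  have [/F_count/countable_injP[i i_inj]|] := pselect (S s); first by exists i.
  by exists (fun=> 0).
pose J n := [set x | (x < theta)%O /\ exists2 u, S u & F u (j x) /\ num u (j x) = n].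
have J_bounded n : exists2 b, (b < theta)%O & forall a, J n a -> (a < b)%O.
  apply: regular_bounded => [x []//|tJ]; apply: not_le.
  have [x0 _] := below_neq0.
  have /choice[G GP] (s : U) : exists x, forall y, S s -> (y < theta)%O ->
      F s (j y) -> num s (j y) = n -> x = y.
    have [[y [yt Fy ny Ss]]|noy] := pselect (exists y,
        [/\ (y < theta)%O, F s (j y), num s (j y) = n & S s]); last first.
      by exists x0 => y Ss yt Fy ny; case: noy; exists y.
    exists y => z _ zt Fz nz; apply: j_inj; rewrite ?inE //.
    by apply: (numP s Ss); rewrite ?inE // nz.
  apply: (card_le_trans tJ); apply: (card_le_trans (B := G @` S)).
    apply: subset_card_le => x [xt [s Ss [Fx nx]]]; exists s => //.
    exact: GP.
  exact: card_image_le.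
have /choice[b bP] n : exists b, (b < theta)%O /\ forall a, J n a -> (a < b)%O.
  by have [b bt bJ] := J_bounded n; exists b.
have [c ct bc] := @regular_seq_bounded b (fun n => (bP n).1).
have [s Ss Fs] := T_F _ (jT _ ct).
have /(bP _).2 : J (num s (j c)) c by split=> //; exists s.
by move=> /lt_trans/(_ (bc _)); rewrite ltxx.
Qed.

End Regular.
End WellOrder.

(** * Directed systems and cocycles *)

Section DirectedSystem.
Variables (R : pzRingType) (d : Order.disp_t) (I : orderType d).
Variable M : directed_system R I.
Implicit Types (a b c s : I) (J X : set I).

(* Zero when [a <= b] fails. *)
Definition trans a b : {linear M a -> M b} :=
  if pselect (a <= b)%O is left ab then ds_map M ab else \0.

Lemma transE a b (ab : (a <= b)%O) x : trans a b x = ds_map M ab x.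
Proof.
rewrite /trans; case: pselect => [ab'|//].
by rewrite (bool_irrelevance ab ab').
Qed.

Lemma trans_id a x : trans a a x = x.
Proof. by rewrite (transE (lexx a)); case: M x => m f f_id f_comp x; apply: f_id. Qed.

Lemma trans_comp a b c x :
  (a <= b)%O -> (b <= c)%O -> trans b c (trans a b x) = trans a c x.
Proof.
move=> ab bc; rewrite (transE ab) (transE bc) (transE (le_trans ab bc)).
by case: M x => m f f_id f_comp x; apply: f_comp.
Qed.

Definition compatible_on J (N : lmodType R) (g : forall a, {linear M a -> N}) : Prop :=
  forall a b x, J a -> J b -> (a <= b)%O -> g b (trans a b x) = g a x.

Lemma direct_limit_ub J s a : is_direct_limit M J s -> J a -> (a <= s)%O.
Proof. by case=> + _; apply. Qed.

Lemma direct_limit_lift J s (N : lmodType R) (g : forall a, {linear M a -> N}) :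
    is_direct_limit M J s -> compatible_on J g ->
  exists h : {linear M s -> N}, forall a x, J a -> h (trans a s x) = g a x.
Proof.
move=> [Js lim] gJ; have [i j ij x Ji Jj|[h hE] _] := lim N g.
  by rewrite -transE gJ.
by exists h => a x Ja; rewrite (transE (Js _ Ja)) hE.
Qed.

Lemma direct_limit_unique J s (N : lmodType R) (h h' : {linear M s -> N}) :
    is_direct_limit M J s ->
    (forall a x, J a -> h (trans a s x) = h' (trans a s x)) ->
  forall x, h x = h' x.
Proof.
move=> [Js lim] hh'; have [i j ij x Ji Jj|_ uniq_h] :=
    lim N (fun a => h \o trans a s).
  by rewrite /= -transE trans_comp //; apply: Js.
by apply: uniq_h => a as_ x Ja; rewrite -transE //= hh'.
Qed.

(** A compatible family on [X] extends to [J] by first moving each [a] to a chosen index [n a] of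
    [X] above it. *)
Lemma direct_limit_cofinal J X s : X `<=` J ->
    (forall a, J a -> exists2 b, X b & (a <= b)%O) ->
  is_direct_limit M J s -> is_direct_limit M X s.
Proof.
move=> XJ X_cof lim; have Js := @direct_limit_ub J s _ lim.
split=> [a /XJ/Js//|N g g_compat factors].
split=> [|h h' hE h'E]; last first.
  apply: (direct_limit_unique lim) => a x Ja; have [b Xb ab] := X_cof a Ja.
  rewrite -(trans_comp x ab) ?(transE (Js _ (XJ _ Xb))); last exact/Js/XJ.
  by rewrite hE // h'E.
have /choice[n nP] a : exists b, J a -> X b /\ (a <= b)%O.
  have [/X_cof[b Xb ab]|] := pselect (J a); first by exists b.
  by exists a.
have gE i j x : X i -> X j -> (i <= j)%O -> g j (trans i j x) = g i x.
  by move=> Xi Xj ij; rewrite (transE ij) g_compat.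
have [a b x Ja Jb ab|h hE] :=
    @direct_limit_lift J s N (fun a => g (n a) \o trans a (n a)) lim.
  have [[Xa an] [Xb bn]] := (nP _ Ja, nP _ Jb); rewrite /= trans_comp //.
  have [nab|/ltW nba] := leP (n a) (n b).
    by rewrite -(gE (n a) (n b)) // trans_comp.
  by rewrite -(gE (n b) (n a)) // trans_comp // (le_trans ab).
exists h => j js x Xj; have [Xn jn] := nP _ (XJ _ Xj).
by rewrite -transE hE /= ?gE //; apply: XJ.
Qed.

(** The images form a submodule because [J] is a chain. The projection of [M s] modulo this
    submodule agrees with zero on every [M a], hence is zero by uniqueness. *)
Lemma direct_limit_surjective J s : J !=set0 -> is_direct_limit M J s ->
  forall y, exists a (x : M a), J a /\ y = trans a s x.
Proof.
move=> [a0 Ja0] lim; have Js := @direct_limit_ub J s _ lim.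
pose W := [set y | exists a (x : M a), J a /\ y = trans a s x].
have Wsub : submodule W.
  split=> [|r _ _ [a [x [Ja ->]]] [b [y [Jb ->]]]].
    by exists a0, 0; rewrite linear0.
  have [ab|/ltW ba] := leP a b.
    exists b, (r *: trans a b x + y); split=> //.
    by rewrite linearP trans_comp // Js.
  exists a, (r *: x + trans b a y); split=> //.
  by rewrite linearP trans_comp // Js.
have [Q [q [q_surj q0]]] := quotient_module Wsub.
move=> y; apply/q0; apply: (direct_limit_unique (h' := \0) lim) => a x Ja /=.
by apply/q0; exists a, x.
Qed.

Definition cocycle_on J (D : lmodType R) (h : I -> forall a, {linear M a -> D}) :=
  forall a b c x, J a -> J b -> J c -> (a < b)%O -> (b < c)%O ->
    h c a x = h c b (trans a b x) + h b a x.

(* [M s] is a quotient of the free module [F] on all pairs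
   [(a, x)], [x : M a].  Sending [(a, x)] to the value at [x] of the cocycle at
   a late stage defines, on the kernel of [F -> M s], a linear map to [D]
   independent of that stage; its extension to [F] is the trivialisation. *)
Lemma cocycle_trivial J s (D : lmodType R) (h : I -> forall a, {linear M a -> D}) :
    J !=set0 -> (forall a, J a -> exists2 b, J b & (a < b)%O) ->
    is_direct_limit M J s -> Ext1_eq0 (M s) D -> cocycle_on J h ->
  exists t : forall a, {linear M a -> D}, forall a b x, J a -> J b -> (a < b)%O ->
    h b a x = t b (trans a b x) - t a x.
Proof.
move=> J_neq0 J_nomax lim ext h_cocycle; have Js := @direct_limit_ub J s _ lim.
pose eventually (P : I -> Prop) :=
  exists2 b, J b & forall c, J c -> (b <= c)%O -> P c.
have evI P Q : eventually P -> eventually Q -> eventually (fun c => P c /\ Q c).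
  move=> [a Ja aP] [b Jb bQ].
  have [ab|/ltW ba] := leP a b; [exists b|exists a] => // c Jc ?; split.
  - by apply: aP => //; apply: le_trans ab _.
  - exact: bQ.
  - exact: aP.
  - by apply: bQ => //; apply: le_trans ba _.
have ev_mono (P Q : I -> Prop) : (forall c, J c -> P c -> Q c) ->
    eventually P -> eventually Q.
  by move=> PQ [b Jb bP]; exists b => // c Jc bc; apply: PQ => //; apply: bP.
have ev_gt a : J a -> eventually (fun c => (a < c)%O).
  by move=> /J_nomax[b Jb ab]; exists b => // c _; apply: lt_le_trans.
have ev_const P : eventually (fun=> P) -> P by move=> [b Jb bP]; apply: (bP b).
have ev_all P : (forall c, J c -> P c) -> eventually P.
  by move=> JP; have [a Ja] := J_neq0; exists a => // c Jc _; apply: JP.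
have [F [e e_free]] := free_module R {a : I & M a}; have [lift ind] := e_free.
have [pi piE] := lift (M s) (fun u =>
  if pselect (J (tag u)) then trans (tag u) s (tagged u) else 0).
(* [ev b] evaluates a formal combination in [M b], and [hv b] applies [h b] to it termwise. Terms
   whose index is not yet below [b] are irrelevant, since only late stages are compared. *)
have ev_lift b := cid (lift (M b) (fun u =>
  if pselect (J (tag u)) then trans (tag u) b (tagged u) else 0)).
have hv_lift b := cid (lift D (fun u =>
  if pselect (J (tag u) /\ (tag u < b)%O) then h b (tag u) (tagged u) else 0)).
pose ev b := sval (ev_lift b); pose hv b := sval (hv_lift b).
pose gen a (x : M a) : F := e (existT (fun a => M a : Type) a x).
have pigen a x : J a -> pi (gen a x) = trans a s x.
  by rewrite piE /=; case: pselect.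
have pigen0 a x : ~ J a -> pi (gen a x) = 0.
  by rewrite piE /=; case: pselect.
have evgen a b x : J a -> ev b (gen a x) = trans a b x.
  by rewrite (svalP (ev_lift b)) /=; case: pselect.
have hvgen a b x : J a -> (a < b)%O -> hv b (gen a x) = h b a x.
  by move=> Ja ab; rewrite (svalP (hv_lift b)) /=; case: pselect => // -[].
have evgen0 a b x : ~ J a -> ev b (gen a x) = 0.
  by rewrite (svalP (ev_lift b)) /=; case: pselect.
have hvgen0 a b x : ~ J a -> hv b (gen a x) = 0.
  by move=> nJa; rewrite (svalP (hv_lift b)) /=; case: pselect => // -[].
(* The cocycle identity, summed over the terms of [n]: [hv] changes between late stages only through
   [ev b n]. *)
have coherent n : eventually (fun b => forall c, J c -> (b < c)%O ->
    ev c n = trans b c (ev b n) /\ hv c n = hv b n + h c b (ev b n)).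
  pose W := [set n | eventually (fun b => forall c, J c -> (b < c)%O ->
    ev c n = trans b c (ev b n) /\ hv c n = hv b n + h c b (ev b n))].
  apply: (ind W) n => [|[a x]].
    split=> [|r x y Wx Wy].
      by apply: ev_all => b Jb c Jc bc; rewrite !linear0 addr0.
    apply: ev_mono (evI _ _ Wx Wy) => b Jb [bx by_] c Jc bc.
    have [ex hx] := bx c Jc bc; have [ey hy] := by_ c Jc bc.
    rewrite !linearP ex hx ey hy; split=> //.
    by rewrite scalerDr addrACA.
  have [Ja|nJa] := pselect (J a); last first.
    apply: ev_all => b Jb c Jc bc.
    by rewrite -/(gen a x) !evgen0 // !hvgen0 // !linear0 addr0.
  apply: ev_mono (ev_gt _ Ja) => b Jb ab c Jc bc.
  have ac := lt_trans ab bc; rewrite -/(gen a x) !evgen // !hvgen //.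
  by rewrite trans_comp ?ltW // addrC; split=> //; apply: h_cocycle.
(* What vanishes in the limit vanishes at some stage: by the universal property [M s] maps to the
   quotient of [F] by the combinations that eventually vanish. *)
have ker_ev n : pi n = 0 -> eventually (fun b => ev b n = 0).
  pose Z := [set n | eventually (fun b => ev b n = 0)].
  have Zsub : submodule Z.
    split; first by apply: ev_all => b _; rewrite linear0.
    move=> r n1 n2 Zx Zy.
    apply: ev_mono (evI _ _ Zx Zy) => b _ [n10 n20].
    by rewrite linearP n10 n20 scaler0 addr0.
  have [Q [q [q_surj q0]]] := quotient_module Zsub.
  have g_lin a : exists g : {linear M a -> Q}, J a -> forall x, g x = q (gen a x).
    have [Ja|nJa] := pselect (J a); last by exists \0.
    have [r x y|g gE] := @linear_bundle _ (M a) Q (fun x => q (gen a x)); last first.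
      by exists g.
    apply/eqP; rewrite -linearP -subr_eq0 -linearB; apply/eqP/q0.
    apply: ev_mono (ev_gt _ Ja) => b Jb ab.
    by rewrite linearB linearP !evgen // linearP subrr.
  pose g a := sval (cid (g_lin a)).
  have gE a x : J a -> g a x = q (gen a x) by move=> Ja; apply: (svalP (cid (g_lin a))).
  have [a b x Ja Jb ab|u uE] := direct_limit_lift (g := g) lim.
    rewrite !gE //; apply/eqP; rewrite -subr_eq0 -linearB; apply/eqP/q0.
    apply: ev_mono (ev_gt _ Jb) => c Jc bc.
    by rewrite linearB !evgen // trans_comp ?subrr // ltW.
  move=> pin; apply/q0; rewrite -[RHS](linear0 u) -pin.
  pose W := [set n | q n = u (pi n)].
  suff Wn : W n by exact: Wn.
  apply: (ind W (submodule_eq q (u \o pi))) => -[a x]; rewrite /W /= -/(gen a x).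
  have [Ja|nJa] := pselect (J a); first by rewrite pigen // uE // gE.
  rewrite pigen0 // linear0; apply/q0.
  by apply: ev_all => b _; rewrite evgen0.
have ker_hv n : pi n = 0 -> exists v, eventually (fun b => hv b n = v).
  move=> /ker_ev n0; have [b Jb bP] := evI _ _ n0 (coherent n).
  exists (hv b n); exists b => // c Jc; rewrite le_eqVlt => /predU1P[<-//|bc].
  have [evb /(_ c Jc bc)[_ ->]] := bP _ Jb (lexx b).
  by rewrite evb linear0 addr0.
(* [phi] is the eventual value of [hv] on the kernel of [pi] and is left unspecified elsewhere. *)
have /choice[phi phiP] n : exists v, pi n = 0 -> eventually (fun b => hv b n = v).
  have [/ker_hv[v vP]|] := pselect (pi n = 0); first by exists v.
  by exists 0.
have phiE n v : pi n = 0 -> eventually (fun b => hv b n = v) -> phi n = v.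
  move=> /phiP phin vn; apply: ev_const; apply: ev_mono (evI _ _ phin vn).
  by move=> c _ [<- <-].
have pi_surj : surjective pi.
  move=> y; have [a [x [Ja ->]]] := direct_limit_surjective J_neq0 lim y.
  by exists (gen a x); apply: pigen.
have [r x y x0 y0|psi psiE] :=
    Ext1_eq0_extend ext (free_projective e_free) pi_surj (phi := phi).
  apply: phiE; first by rewrite linearP x0 y0 scaler0 addr0.
  apply: ev_mono (evI _ _ (phiP _ x0) (phiP _ y0)) => b _ [<- <-].
  exact: linearP.
have psi_val n v : pi n = 0 -> eventually (fun b => hv b n = v) -> psi n = v.
  by move=> n0 nv; rewrite psiE //; apply: phiE.
(* [gen a] is not linear, but its defects lie in the kernel of [pi] and have eventual value zero. *)
have t_lin a : exists t : {linear M a -> D}, J a -> forall x, t x = - psi (gen a x).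
  have [Ja|nJa] := pselect (J a); last by exists \0.
  have [r x y|t tE] := @linear_bundle _ (M a) D (fun x => - psi (gen a x)); last first.
    by exists t.
  apply/eqP; rewrite scalerN -opprD eqr_opp -linearP -subr_eq0 -linearB; apply/eqP.
  apply: psi_val; first by rewrite linearB linearP !pigen // linearP subrr.
  apply: ev_mono (ev_gt _ Ja) => b Jb ab.
  by rewrite linearB linearP !hvgen // linearP subrr.
(* The combination [gen a x - gen b (trans a b x)] lies in the kernel of [pi], with eventual value
   [h b a x]; this explains the sign in [t]. *)
exists (fun a => sval (cid (t_lin a))) => a b x Ja Jb ab.
rewrite (svalP (cid (t_lin a))) // (svalP (cid (t_lin b))) // opprK addrC -linearB.
apply/esym/psi_val; first by rewrite linearB !pigen // trans_comp ?subrr ?Js // ltW.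
apply: ev_mono (ev_gt _ Jb) => c Jc bc.
have ac := lt_trans ab bc.
rewrite linearB !hvgen // (h_cocycle a b c) //.
by rewrite addrAC subrr add0r.
Qed.

End DirectedSystem.

(** * Transfinite constructions along a set of indices *)

Section Recursion.
Variables (R : pzRingType) (d : Order.disp_t) (I : orderType d).
Hypothesis I_wo : well_order (<=%O : rel I).
Variable M : directed_system R I.
Implicit Types (a b c : I) (X : set I).

Definition pred_in X c b : Prop :=
  [/\ X c, (c < b)%O & forall a, X a -> (a < b)%O -> (a <= c)%O].

Definition limit_in X b : Prop :=
  (exists2 a, X a & (a < b)%O) /\
  forall a, X a -> (a < b)%O -> exists c, [/\ X c, (a < c)%O & (c < b)%O].

Lemma pred_limit X b :
  [\/ exists c, pred_in X c b, limit_in X b | forall a, X a -> ~ (a < b)%O].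
Proof.
have [[c Xcb]|nopred] := pselect (exists c, pred_in X c b).
  by apply: Or31; exists c.
have [a_b|noa] := pselect (exists2 a, X a & (a < b)%O); last first.
  by apply: Or33 => a Xa ab; apply: noa; exists a.
apply: Or32; split=> // a Xa ab; apply: contrapT => noc; apply: nopred.
exists a; split=> // c Xc cb; rewrite leNgt; apply/negP => ac.
by apply: noc; exists c.
Qed.

Definition continuous_on X : Prop := forall b, X b -> limit_in X b ->
  is_direct_limit M [set a | X a /\ (a < b)%O] b.

(** At limit stages the lifts are glued. The top index [theta] will be such a stage, and the
    vanishing of Ext there is what the lifts serve to prove. *)
Lemma coherent_lifts X (D E N : lmodType R) (j : {linear D -> E})
    (p : {linear E -> N}) (u : forall a, {linear M a -> N}) :
    surjective p -> injective j -> exact_at j p ->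
    continuous_on X -> compatible_on X u ->
    (forall b, X b -> limit_in X b \/ Ext1_eq0 (M b) D) ->
    (forall c b, X b -> pred_in X c b -> hom_injective D (trans M c b)) ->
  exists s : forall a, {linear M a -> E},
    compatible_on X s /\ forall a x, X a -> p (s a x) = u a x.
Proof.
move=> p_surj j_inj ex X_cont u_compat X_ext X_inj.
have /exact_atP[pj ker_p] := ex.
have lift b : Ext1_eq0 (M b) D ->
    exists v : {linear M b -> E}, forall x, p (v x) = u b x.
  by move=> ext; apply: Ext1_eq0_lift ext p_surj j_inj ex.
pose Phi b (s : forall a, {linear M a -> E}) (v : {linear M b -> E}) := X b ->
  (forall x, p (v x) = u b x) /\
  (forall a x, X a -> (a < b)%O -> v (trans M a b x) = s a x).
have [|b s s' v ss'|b s IH|s sP] := @transfinite_choice _ _ I_wo _ Phi.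
- by move=> a; constructor; exact: \0.
- move=> Phi_s Xb; have [pv vs] := Phi_s Xb; split=> // a x Xa ab.
  by rewrite vs ?ss'.
- have [Xb|nXb] := pselect (X b); last by exists \0.
  have compat_b : compatible_on [set a | X a /\ (a < b)%O] s.
    move=> a a' x [Xa _] [Xa' a'b]; rewrite le_eqVlt => /predU1P[<-|aa'].
      by rewrite trans_id.
    by have [_ ->] := IH a' a'b Xa'.
  have [[c Xcb]|b_lim|b_min] := pred_limit X b.
  + have [Xc cb c_max] := Xcb.
    have [b_lim|/lift[v0 pv0]] := X_ext b Xb.
      have [_ /(_ c Xc cb)[c' [Xc' cc' c'b]]] := b_lim.
      by have := c_max c' Xc' c'b; rewrite leNgt cc'.
    (* Two lifts of [u c] differ by a map into [D]; its extension to [M b], added to [v0], makes the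
       new lift restrict to [s c]. *)
    have /choice[delta deltaE] (x : M c) : exists y, j y = s c x - v0 (trans M c b x).
      apply: ker_p; rewrite linearB /= pv0 u_compat ?ltW //.
      by have [-> _] := IH c cb Xc; rewrite subrr.
    have [r x y|delta1 delta1E] := @linear_bundle _ (M c) D delta.
      apply: j_inj; rewrite linearP !deltaE (linearP (s c)) (linearP (trans M c b)).
      by rewrite (linearP v0) opprD addrACA scalerBr.
    have [delta' delta'E] := X_inj c b Xb Xcb delta1.
    have [r x y|v vE] := @linear_bundle _ (M b) E (fun x => v0 x + j (delta' x)).
      by rewrite (linearP v0) (linearP delta') (linearP j) scalerDr addrACA.
    exists v => _; split=> [x|a x Xa ab].
      by rewrite vE linearD /= pj addr0 pv0.
    have ac := c_max a Xa ab.
    rewrite vE -(trans_comp x ac (ltW cb)) delta'E delta1E deltaE addrC subrK.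
    by apply: compat_b.
  + have b_dl := X_cont b Xb b_lim.
    have [v vE] := direct_limit_lift b_dl compat_b.
    exists v => _; split=> [|a x Xa ab]; last exact: vE.
    apply: (direct_limit_unique (h := p \o v) b_dl) => a x [Xa ab] /=.
    rewrite vE // u_compat ?ltW //.
    by have [-> _] := IH a ab Xa.
  + have [[[a Xa ab] _]|/lift[v pv]] := X_ext b Xb; first by case: (b_min a).
    by exists v => _; split=> // a x Xa /(b_min a Xa).
exists s; split=> [a b x Xa Xb|a x Xa]; last by have [-> _] := sP a Xa.
rewrite le_eqVlt => /predU1P[<-|ab]; first by rewrite trans_id.
by have [_ ->] := sP b Xb.
Qed.

(* At a limit stage the vanishing of Ext provides a trivialisation of the cocycle
   built so far, but with uncontrolled values; composing it with [cut b] keeps it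
   a trivialisation, since the values of that cocycle already lie in [S b]. *)
Lemma cocycle_exists X (D : lmodType R) (S : I -> set D)
    (cut : I -> {linear D -> D}) (g : forall a, {linear M a -> D}) :
    continuous_on X ->
    (forall b, X b -> limit_in X b -> Ext1_eq0 (M b) D) ->
    (forall b, submodule (S b)) -> (forall a b, (a <= b)%O -> S a `<=` S b) ->
    (forall b y, S b (cut b y)) -> (forall b y, S b y -> cut b y = y) ->
    (forall c b x, X b -> pred_in X c b -> S b (g c x)) ->
  exists h : I -> forall a, {linear M a -> D},
    [/\ cocycle_on X h,
        forall a b x, X a -> X b -> (a < b)%O -> S b (h b a x) &
        forall c b x, X b -> pred_in X c b -> h b c x = g c x].
Proof.
move=> X_cont X_ext S_sub S_mono cutS cut_id gS.
pose Phi b (h : I -> forall a, {linear M a -> D}) (v : forall a, {linear M a -> D}) :=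
  X b -> [/\ forall a c x, X a -> X c -> (a < c)%O -> (c < b)%O ->
               v a x = v c (trans M a c x) + h c a x,
             forall a x, X a -> (a < b)%O -> S b (v a x) &
             forall c x, pred_in X c b -> v c x = g c x].
have [|b h h' v hh'|b h IH|h hP] := @transfinite_choice _ _ I_wo _ Phi.
- by move=> a; constructor => ?; exact: \0.
- move=> Phi_h Xb; have [v_coc vS vg] := Phi_h Xb; split=> // a c x Xa Xc ac cb.
  by rewrite -hh' //; apply: v_coc.
- have [Xb|nXb] := pselect (X b); last by exists (fun=> \0).
  have [[c Xcb]|b_lim|b_min] := pred_limit X b.
  + have [Xc cb c_max] := Xcb.
    (* The cocycle identity through [c] dictates the values; at [a = c] the second term is taken to
       be zero, which leaves [g c]. *)
    pose w a : {linear M a -> D} := if (a < c)%O then h c a else \0.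
    have v_lin a : exists v : {linear M a -> D},
        forall x, v x = g c (trans M a c x) + w a x.
      apply: linear_bundle => r x y.
      rewrite (linearP (trans M a c)) (linearP (g c)) (linearP (w a)).
      by rewrite scalerDr addrACA.
    pose v a := sval (cid (v_lin a)).
    have vE a x : v a x = g c (trans M a c x) + w a x := svalP (cid (v_lin a)) x.
    have [h_coc hS _] := IH c cb Xc.
    exists v => _; split=> [a a' x Xa Xa' aa' a'b|a x Xa ab|c' x [Xc' c'b c'_max]].
    * have a'c := c_max a' Xa' a'b.
      rewrite !vE (trans_comp _ (ltW aa') a'c) -addrA; congr (_ + _).
      rewrite /w (lt_le_trans aa' a'c).
      move: a'c; rewrite le_eqVlt => /predU1P[->|a'c]; first by rewrite ltxx add0r.
      by rewrite a'c /=; apply: h_coc.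
    * rewrite vE -[X in X + _]scale1r; apply: (S_sub b).2; first exact: gS.
      rewrite /w; case: ifP => [ac|_]; last exact: (S_sub b).1.
      by apply: S_mono (ltW cb) _ _; apply: hS.
    * have cc' : c' = c by apply/le_anti; rewrite c_max //= c'_max.
      by move: x; rewrite cc' => x; rewrite vE trans_id /w ltxx addr0.
  + have h_coc : cocycle_on [set a | X a /\ (a < b)%O] h.
      move=> a a' c x [Xa ab] [Xa' a'b] [Xc cb] aa' a'c.
      by have [h_c _ _] := IH c cb Xc; apply: h_c.
    have [[a0 Xa0 a0b] b_nomax] := b_lim.
    have [||t tE] := cocycle_trivial _ _ (X_cont b Xb b_lim) (X_ext b Xb b_lim) h_coc.
    * by exists a0.
    * by move=> a [Xa ab]; have [c [Xc ac cb]] := b_nomax a Xa ab; exists c.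
    have v_lin a : exists v : {linear M a -> D}, forall x, v x = - cut b (t a x).
      apply: linear_bundle => r x y.
      by rewrite (linearP (t a)) (linearP (cut b)) opprD scalerN.
    pose v a := sval (cid (v_lin a)).
    have vE a x : v a x = - cut b (t a x) := svalP (cid (v_lin a)) x.
    exists v => _; split=> [a c x Xa Xc ac cb|a x Xa ab|c x [Xc cb c_max]].
    * have [_ hS _] := IH c cb Xc.
      have Sh : S b (h c a x) by apply: S_mono (ltW cb) _ _; apply: hS.
      have ab := lt_trans ac cb.
      by rewrite !vE -(cut_id _ _ Sh) tE // linearB addrA addNr add0r.
    * by rewrite vE -linearN.
    * have [c' [Xc' cc' c'b]] := b_nomax c Xc cb.
      by have := c_max c' Xc' c'b; rewrite leNgt cc'.
  + exists (fun=> \0) => _; split=> [a c x Xa Xc ac cb|a x Xa ab|c x [Xc cb _]].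
    * by case: (b_min c).
    * by case: (b_min a).
    * by case: (b_min c).
exists h; split=> [a b c x Xa Xb Xc ab bc|a b x Xa Xb ab|c b x Xb Xcb].
- by have [h_coc _ _] := hP c Xc; apply: h_coc.
- by have [_ hS _] := hP b Xb; apply: hS.
- by have [_ _ hg] := hP b Xb; apply: hg.
Qed.

End Recursion.

(** * Continuous systems along a regular cardinal *)

Section ContinuousSystem.
Variables (R : pzRingType) (d : Order.disp_t) (I : orderType d).
Hypothesis I_wo : well_order (<=%O : rel I).
Variable theta : I.
Hypothesis theta_reg : uncountable_regular_cardinal theta.
Variable M : directed_system R I.
Hypothesis M_cont : continuous_system M theta.
Hypothesis M_lim : is_direct_limit M (below theta) theta.
Implicit Types (a b c z : I) (X : set I) (D : lmodType R).

Lemma club_above X a : club theta X -> (a < theta)%O ->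
  exists b, [/\ X b, (a < b)%O & (b < theta)%O].
Proof.
move=> [[Xt X_cof] _] at_; have [b bt ab] := regular_succ theta_reg at_.
have [c Xc bc] := X_cof b bt; exists c.
by split=> //; [exact: lt_le_trans bc | exact: Xt].
Qed.

Lemma club_limit X : club theta X -> limit_in (X `|` [set theta]) theta.
Proof.
move=> X_club; split=> [|a _ at_].
  have [a at_] := below_neq0 theta_reg.
  by have [b [Xb _ bt]] := club_above X_club at_; exists b => //; left.
by have [b [Xb ab bt]] := club_above X_club at_; exists b; split=> //; left.
Qed.

(** At [theta] this is cofinality. At a limit [b] in [X], continuity provides the supremum [s] of
    the earlier elements of [X]; were [s < b], closedness would put [s] in [X], with a further
    element of [X] between [s] and [b]. *)
Lemma club_continuous X : club theta X -> continuous_on M (X `|` [set theta]).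
Proof.
move=> X_club b + [[a0 Xa0 a0b] b_nomax]; have [[Xt X_cof] X_closed] := X_club.
set X' := X `|` [set theta] in Xa0 b_nomax *.
have X'X a : X' a -> (a < theta)%O -> X a by case=> // ->; rewrite ltxx.
case=> [Xb|-> {b a0b b_nomax}]; last first.
  apply: direct_limit_cofinal M_lim => [a []//|a at_].
  have [c [Xc ac ct]] := club_above X_club at_.
  by exists c; [split=> //; left | exact: ltW].
have bt : (b < theta)%O by apply: Xt.
set J := [set a | X' a /\ (a < b)%O].
have [s [s_ub s_min] J_lim] : exists2 s, supremums J s & is_direct_limit M J s.
  apply: M_cont; first by exists a0.
  split; first by apply: subset_card_le => a [_ ab]; apply: lt_trans bt.
  move=> tJ; have [_ /(_ b bt)[_ nle] _] := theta_reg; apply: nle.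
  by apply: card_le_trans tJ _; apply: subset_card_le => a [].
have sb : (s <= b)%O by apply: s_min => a [_ /ltW].
suff <- : s = b by [].
apply/le_anti; rewrite sb leNgt; apply/negP => sltb.
have Xs : X s.
  apply: (X_closed J); last by split.
  - by move=> a [Xa ab]; apply: X'X => //; apply: lt_trans bt.
  - by exists a0.
  - exact: lt_trans bt.
have [c [Xc sc cb]] := b_nomax s (or_introl Xs) sltb.
by have := s_ub c (conj Xc cb); rewrite leNgt sc.
Qed.

Lemma club_hom_injective_Ext1 D X : club theta X ->
    (forall a, (a < theta)%O -> Ext1_eq0 (M a) D) ->
    (forall a b (ab : (a < b)%O), X a -> X b ->
       hom_injective D (ds_map M (ltW ab))) ->
  Ext1_eq0 (M theta) D.
Proof.
move=> X_club M_ext X_inj; have [[Xt X_cof] _] := X_club.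
have [_ t_nomax] := club_limit X_club.
have X't a : (X `|` [set theta]) a -> (a <= theta)%O.
  by case=> [/Xt/ltW|->].
apply: Ext1_eq0_split => E j p p_surj j_inj ex.
have [|b|c b|s [s_compat s_lift]] := coherent_lifts I_wo
    (u := fun a => trans M a theta) p_surj j_inj ex (club_continuous X_club).
- by move=> a b x Xa Xb ab; rewrite trans_comp ?X't.
- by case=> [Xb|->]; [right; apply/M_ext/Xt | left; apply: club_limit].
- move=> X'b [X'c cb c_max] g.
  have Xb : X b.
    case: X'b => [//|bt]; rewrite bt in cb c_max.
    have [c' [Xc' cc' c't]] := t_nomax c X'c cb.
    by have := c_max c' Xc' c't; rewrite leNgt cc'.
  have Xc : X c by case: X'c cb => // ->; rewrite ltNge ltW //; apply: Xt.
  have [h hE] := X_inj c b cb Xc Xb g.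
  by exists h => x; rewrite (transE (ltW cb)).
by exists (s theta) => x; rewrite s_lift ?trans_id //; right.
Qed.

(** * Coordinates indexed by [theta], and the necessity of the club *)

Section Supports.
Variables (K : Type) (C : lmodType R) (e : I -> K).
Hypothesis e_inj : {in below theta &, injective e}.
Local Notation D := (dirsum K C).

(** Coordinates outside the image of [below theta] under [e] are left free. *)
Definition vanishes_from b : set D :=
  [set y | forall z, (b <= z)%O -> (z < theta)%O -> y (e z) = 0].

Lemma vanishes_from_submodule b : submodule (vanishes_from b).
Proof.
split=> [z //|a x y x0 y0 z bz zt].
by rewrite dirsumD dirsumZ x0 // y0 // scaler0 addr0.
Qed.

Lemma vanishes_from_mono a b : (a <= b)%O -> vanishes_from a `<=` vanishes_from b.
Proof. by move=> ab y y0 z bz; apply: y0; apply: le_trans bz. Qed.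

(** The map erases the coordinates [e z] with [b <= z < theta]. *)
Lemma cut_exists b : exists l : {linear D -> D},
  [/\ forall y, vanishes_from b (l y), forall y, vanishes_from b y -> l y = y &
      forall y : D, (forall k, y k != 0 ->
        exists z, [/\ (b <= z)%O, (z < theta)%O & k = e z]) -> l y = 0].
Proof.
pose tail k := exists z, [/\ (b <= z)%O, (z < theta)%O & k = e z].
have [k k' k0|l lE] := @dirsum_reindex R K C
    (fun k => if pselect (tail k) then None else Some k).
  by case: pselect => // _ [->]; case: pselect => // _ [->].
exists l; split=> [y z bz zt|y y0|y y_tail].
- by rewrite lE; case: pselect => // -[]; exists z.
- apply: dirsum_ext => k; rewrite lE; case: pselect => //= -[z [bz zt kE]].
  by rewrite kE y0.
- apply: dirsum_ext => k; rewrite lE; case: pselect => //= ntail.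
  by apply: contra_notP ntail => /eqP/y_tail.
Qed.

(** The support of [g] is covered by the finite supports of the images of fewer than [theta]
    generators. *)
Lemma small_support (N : lmodType R) (g : {linear N -> D}) :
    lt_generated N (below theta) ->
  ~ (below theta #<= [set k | exists x, g x k != 0]).
Proof.
move=> [S S_lt S_gen].
apply: (not_le_countable_union theta_reg (S := S)
    (F := fun s => [set k | g s k != 0])).
- by case: S_lt.
- by move=> s _; apply/finite_set_countable/dirsum_finite.
move=> k [x gx]; have [n [a [s [Ss xE]]]] := S_gen x.
apply: contrapT => noS; move/eqP: gx; apply.
rewrite xE linear_sum.
have sum0 (r : seq 'I_n) : (\sum_(i <- r) g (a i *: s i)) k = 0.
  elim: r => [|i r IH]; first by rewrite big_nil.
  rewrite big_cons dirsumD IH addr0 linearZ dirsumZ.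
  case: (eqVneq (g (s i) k) 0) => [->|nz]; first by rewrite scaler0.
  by case: noS; exists (s i).
exact: sum0.
Qed.

Lemma support_bounded (N : lmodType R) (g : {linear N -> D}) :
    lt_generated N (below theta) ->
  exists2 b, (b < theta)%O & forall x, vanishes_from b (g x).
Proof.
move=> N_gen.
have [||b bt bP] := @regular_bounded _ _ _ theta_reg
    [set z | (z < theta)%O /\ exists x, g x (e z) != 0].
- by move=> z [].
- move=> tle; apply: (small_support (g := g) N_gen); apply: card_le_trans tle _.
  have [J0|J0] := pselect ([set z | (z < theta)%O /\ exists x, g x (e z) != 0] !=set0).
    apply/inj_card_leP => //; exists e => [z []//|z z'].
    by rewrite !inE => -[zt _] [zt' _]; apply: e_inj; rewrite inE.
  by move/set0P/negP/negPn/eqP: J0 => ->; apply: card_ge0.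
exists b => // x z bz zt; apply: contrapT => /eqP gz.
by have := bP z (conj zt (ex_intro _ x gz)); rewrite ltNge bz.
Qed.

(* There is room: [g] uses fewer than theta coordinates, and theta coordinates
   [e z] have [b <= z]. *)
Lemma support_transport (N : lmodType R) (g : {linear N -> D}) b :
    lt_generated N (below theta) -> (b < theta)%O ->
  exists c (g' : {linear N -> D}) (l : {linear D -> D}),
    [/\ (c < theta)%O, forall x, l (g' x) = g x &
        forall x k, g' x k != 0 -> exists z, [/\ (b <= z)%O, (z < c)%O & k = e z]].
Proof.
move=> N_gen bt; set T := [set k | exists x, g x k != 0].
have nle := small_support (g := g) N_gen; rewrite -/T in nle.
have [T0|T0] := pselect (T !=set0); last first.
  exists b, \0, \0; split=> // x; last by move=> k /eqP nz; case: nz.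
  apply: dirsum_ext => k /=; apply/esym/eqP; apply: contrapT => /negP gk.
  by apply: T0; exists k, x.
have [b0 b0t T_b0] := not_le_card_below I_wo theta_reg nle.
pose J := [set z | (b <= z)%O /\ (z < theta)%O].
have T_J : T #<= J.
  apply: (card_le_trans T_b0); apply: (card_le_trans (B := below theta)).
    by apply: subset_card_le => z zb; apply: lt_trans b0t.
  have [_ _ reg] := theta_reg.
  have := reg J (cofinal_above bt).
  by rewrite card_eq_le => /andP[].
have /(inj_card_leP _ T0)[i iJ i_inj] := T_J.
have [||c ct cP] := @regular_bounded _ _ _ theta_reg (i @` T).
- by move=> _ [k /iJ[_ it] <-].
- by move=> tle; apply: nle; apply: card_le_trans tle (card_image_le _ _).
have ei_inj : {in T &, injective (e \o i)}.
  move=> k k' kT k'T /=; move: (kT) (k'T); rewrite !inE => /iJ[_ it] /iJ[_ it'].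
  by move/e_inj; rewrite !inE => /(_ it it'); apply: i_inj.
(* [r1] is the partial inverse of [e \o i] on [T]: [fwd] moves each coordinate [k] of [T] to
   [e (i k)], and [bwd] moves it back. *)
have /choice[r1 r1P] (k : K) : exists o : option K,
    if o is Some k0 then T k0 /\ k = e (i k0)
    else forall k0, T k0 -> k <> e (i k0).
  have [[k0 [Tk0 kE]]|nok] := pselect (exists k0, T k0 /\ k = e (i k0)).
    by exists (Some k0).
  by exists None => k0 Tk0 kE; apply: nok; exists k0.
have [k k' k0 r1k r1k'|fwd fwdE] := @dirsum_reindex R K C r1.
  by move: (r1P k) (r1P k'); rewrite r1k r1k' => -[_ ->] [_ ->].
have [k k' k0|bwd bwdE] := @dirsum_reindex R K C
    (fun k => if pselect (T k) then Some (e (i k)) else None).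
  case: pselect => // Tk [<-]; case: pselect => // Tk' [kk'].
  by apply: ei_inj; rewrite ?inE //=.
exists c, (fwd \o g), bwd; split=> // x => [|k /=].
  apply: dirsum_ext => k; rewrite bwdE; case: pselect => [Tk|nTk].
    rewrite /= fwdE; move: (r1P (e (i k))); case: (r1 _) => [k0 [Tk0 kk0]|].
      by congr (g x _); apply: ei_inj; rewrite ?inE //=.
    by move=> /(_ k Tk).
  by apply/esym/eqP; apply: contrapT => /negP gk; apply: nTk; exists x.
rewrite fwdE; move: (r1P k); case: (r1 k) => [k0 [Tk0 ->] _|]; last by rewrite eqxx.
exists (i k0); split=> //; first by have [] := iJ k0 Tk0.
by apply: cP; exists k0.
Qed.

Hypothesis M_gen : forall a, (a < theta)%O -> lt_generated (M a) (below theta).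
Hypothesis M_ext : forall a, (a < theta)%O -> Ext1_eq0 (M a) D.

Definition all_injective_from a : Prop :=
  forall b, (a < b)%O -> (b < theta)%O -> hom_injective D (trans M a b).

(** Moving the support of a map that does not extend keeps it from extending, since [l] would carry
    an extension back. If every map out of [M a] is injective, the zero map fills the slot. *)
Lemma witness_exists a : exists w : {linear M a -> D} * (I * I), (a < theta)%O ->
  let: (g, (b, c)) := w in
  [/\ (b < theta)%O, (c < theta)%O,
      all_injective_from a \/ ((a < b)%O /\
        ~ exists h : {linear M b -> D}, forall x, h (trans M a b x) = g x) &
      forall x k, g x k != 0 -> exists z, [/\ (a <= z)%O, (z < c)%O & k = e z]].
Proof.
have [at_|] := pselect (a < theta)%O; last by exists ((\0 : {linear M a -> D}), (a, a)).
have [good|bad] := pselect (all_injective_from a).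
  exists ((\0 : {linear M a -> D}), (a, a)) => _; split=> //; first by left.
  by move=> x k /eqP nz; case: nz.
have [b [ab bt [g no_h]]] : exists b, [/\ (a < b)%O, (b < theta)%O &
    exists g : {linear M a -> D},
      ~ exists h : {linear M b -> D}, forall x, h (trans M a b x) = g x].
  apply: contrapT => nob; apply: bad => b ab bt g; apply: contrapT => no_h.
  by apply: nob; exists b; split=> //; exists g.
have [c [g' [l [ct lg' g'_supp]]]] := support_transport g (M_gen at_) at_.
exists (g', (b, c)) => _; split=> //; right; split=> // -[h hE].
by apply: no_h; exists (l \o h) => x /=; rewrite hE.
Qed.

Lemma Ext1_club_hom_injective : Ext1_eq0 (M theta) D ->
  exists X, club theta X /\ forall a, X a -> all_injective_from a.
Proof.
move=> t_ext.
pose w a := sval (cid (witness_exists a)).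
pose g a := (w a).1; pose beta a := (w a).2.1; pose rho a := (w a).2.2.
have wP a : (a < theta)%O ->
  [/\ (beta a < theta)%O, (rho a < theta)%O,
      all_injective_from a \/ ((a < beta a)%O /\
        ~ exists h : {linear M (beta a) -> D},
            forall x, h (trans M a (beta a) x) = g a x) &
      forall x k, g a x k != 0 -> exists z, [/\ (a <= z)%O, (z < rho a)%O & k = e z]].
  rewrite /g /beta /rho /w; case: (cid _) => -[g0 [b0 c0]] /= gP; exact: gP.
pose F a := Order.max (beta a) (rho a).
have Ft a : (a < theta)%O -> (F a < theta)%O.
  by move=> /wP[bt ct _ _]; rewrite gt_max bt ct.
have [a0 a0t] := below_neq0 theta_reg.
have X_club := club_closure_points I_wo theta_reg a0t Ft.
set X := (X in club theta X) in X_club.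
have X_beta a b : X b -> (a < b)%O -> (beta a <= b)%O.
  by move=> [_ _ bP] /bP; rewrite ge_max => /andP[].
have X_rho a b : X b -> (a < b)%O -> (rho a <= b)%O.
  by move=> [_ _ bP] /bP; rewrite ge_max => /andP[].
have Xt a : X a -> (a < theta)%O by case.
pose X' := X `|` [set theta].
have X'X a : X' a -> (a < theta)%O -> X a by case=> // ->; rewrite ltxx.
pose cut b := sval (cid (cut_exists b)).
have cutP b := svalP (cid (cut_exists b)).
have [||||||h [h_coc hS hg]] := cocycle_exists I_wo (S := vanishes_from)
    (cut := cut) (g := g) (club_continuous X_club).
- by move=> b [/Xt/M_ext|->].
- exact: vanishes_from_submodule.
- exact: vanishes_from_mono.
- by move=> b y; have [] := cutP b.
- by move=> b y; have [_ + _] := cutP b; apply.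
(* [g c] lives on [e ([c, rho c))], and [rho c <= b] for [b] in the club; at [b = theta] the range
   of [z] is empty. *)
- move=> c b x X'b [X'c cb _] z bz zt; apply: contrapT => /eqP gz.
  have bt : (b <= theta)%O by case: X'b => [/Xt/ltW|->].
  have [_ _ _ /(_ x _ gz)[z' [cz' z'r ezz']]] := wP c (lt_le_trans cb bt).
  have [_ rt _ _] := wP c (lt_le_trans cb bt).
  have zz' : z = z' by apply: e_inj; rewrite ?inE //; apply: lt_trans rt.
  case: X'b => [Xb|bE].
    by move: z'r; rewrite -zz' ltNge (le_trans (X_rho c b Xb cb) bz).
  by move: bz; rewrite bE leNgt zt.
have /choice[tau tauP] a : exists b, (a < theta)%O ->
    (b < theta)%O /\ forall x, vanishes_from b (h theta a x).
  have [at_|] := pselect (a < theta)%O; last by exists a.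
  by have [b bt bP] := support_bounded (h theta a) (M_gen at_); exists b.
(* Closure under [n] makes the points of the second club limits of [X]. *)
have /choice[n nP] a : exists b, (a < theta)%O ->
    (b < theta)%O /\ exists c, [/\ X c, (a < c)%O & (c < b)%O].
  have [at_|] := pselect (a < theta)%O; last by exists a.
  have [c [Xc ac ct]] := club_above X_club at_.
  by have [b bt cb] := regular_succ theta_reg ct; exists b => _; split=> //; exists c.
pose F' a := Order.max (F a) (Order.max (tau a) (n a)).
have F't a : (a < theta)%O -> (F' a < theta)%O.
  by move=> at_; rewrite gt_max Ft // gt_max (tauP a at_).1 (nP a at_).1.
(* Starting strictly above [a0] guarantees that [X] has elements below every point of [Y]. *)
have [a1 a1t a01] := regular_succ theta_reg a0t.
have Y_club := club_closure_points I_wo theta_reg a1t F't.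
set Y := (X in club theta X) in Y_club.
exists Y; split=> // a [a1a at_ aP].
have aF c : (c < a)%O -> [/\ (F c <= a)%O, (tau c <= a)%O & (n c <= a)%O].
  by move=> /aP; rewrite ge_max => /andP[-> +]; rewrite ge_max => /andP[-> ->].
have Xa : X a.
  split=> // [|c /aF[]//]; exact: le_trans (ltW a01) a1a.
have X'a : X' a by left.
have a_nomax c : (c < a)%O -> exists b, [/\ X' b, (c < b)%O & (b < a)%O].
  move=> ca; have [_ [b [Xb cb bn]]] := nP c (lt_trans ca at_).
  exists b; split=> //; first by left.
  by have [_ _ na] := aF c ca; apply: lt_le_trans na.
have a_lim : limit_in X' a.
  split=> [|c _]; last exact: a_nomax.
  by have [b [Xb _ ba]] := a_nomax a0 (lt_le_trans a01 a1a); exists b.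
(* Such a [y] comes from some [x] at a stage [c < a] in [X], and [h theta a y] is
   [h theta c x - h a c x]; [tau c <= a] bounds the first term, the construction of [h] the
   second. *)
have ht_vanish y : vanishes_from a (h theta a y).
  have [|c [x [[X'c ca] ->]]] :=
      direct_limit_surjective _ (club_continuous X_club X'a a_lim) y.
    by have [[c X'c ca] _] := a_lim; exists c.
  have [_ tc _] := aF c ca.
  have -> : h theta a (trans M c a x) = - 1 *: h a c x + h theta c x.
    rewrite (h_coc c a theta) //; last by right.
    by rewrite scaleN1r addrC addrK.
  apply: (vanishes_from_submodule a).2; first exact: hS.
  by apply: vanishes_from_mono tc _ _; apply: (tauP c (lt_trans ca at_)).2.
have [b [[Xb ab] b_min]] := @wo_min _ _ I_wo [set b | X b /\ (a < b)%O]
  (let: ex_intro b (And3 Xb ab _) := club_above X_club at_ in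
   ex_intro _ b (conj Xb ab)).
have a_pred : pred_in X' a b.
  split=> // c X'c cb; rewrite leNgt; apply/negP => ac.
  have /b_min : X c /\ (a < c)%O.
    by split=> //; apply: X'X => //; apply: lt_trans (Xt b Xb).
  by rewrite leNgt cb.
have X'b : X' b by left.
have [cutS cut_id cut0] := cutP a.
(* Minus the part of [h theta b] on the coordinates [e z] with [a <= z < theta]. On the image of
   [M a], [h theta b] is [h theta a - g a]; [cut a] fixes the first term and kills the second, so
   [f] returns [g a]. *)
have [f fE] : exists f : {linear M b -> D}, forall y,
    f y = cut a (h theta b y) - h theta b y.
  apply: linear_bundle => r x y.
  rewrite (linearP (h theta b)) (linearP (cut a)) opprD addrACA.
  by rewrite scalerBr.
have g_factor x : f (trans M a b x) = g a x.
  have hE : h theta b (trans M a b x) = h theta a x - g a x.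
    rewrite (h_coc a b theta) //; [|by right|exact: Xt].
    by rewrite (hg a b) // addrK.
  have [_ _ _ g_supp] := wP a at_.
  have cut_g : cut a (g a x) = 0.
    apply: cut0 => k /g_supp[z [az zr kE]]; exists z; split=> //.
    by have [_ rt _ _] := wP a at_; apply: lt_trans rt.
  rewrite fE hE (linearB (cut a)) cut_g subr0 (cut_id _ (ht_vanish x)).
  by rewrite opprB addrC subrK.
(* As [beta a <= b], restricting [f] to [M (beta a)] would extend [g a], so only the first
   alternative survives. *)
have [_ _ [//|[a_beta no_h]] _] := wP a at_.
case: no_h; exists (f \o trans M (beta a) b) => x /=.
by rewrite (trans_comp _ (ltW a_beta) (X_beta a b Xb ab)) g_factor.
Qed.

End Supports.
End ContinuousSystem.

(* I is the ordinal theta + 1, so that theta is its top element; kappa is the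
   cardinality of K. *)
Theorem theorem1p9
  (R : pzRingType)
  (d : Order.disp_t) (I : tOrderType d)
  (I_wo : well_order (<=%O : rel I))
  (theta : I) (theta_top : theta = \top%O)
  (theta_reg : uncountable_regular_cardinal theta)
  (K : Type) (K_unc : ~ countable [set: K])
  (theta_le_K : below theta #<= [set: K])
  (C : lmodType R^c)
  (M : directed_system R^c I)
  (M_cont : continuous_system M theta)
  (M_lim : is_direct_limit M (below theta) theta)
  (M_gen : forall alpha : I, (alpha < theta)%O ->
     lt_generated (M alpha) (below theta))
  (M_ext : forall alpha : I, (alpha < theta)%O ->
     Ext1_eq0 (M alpha) (dirsum K C)) :
  Ext1_eq0 (M theta) (dirsum K C)
  <->
  exists X : set I, club theta X /\
    forall (alpha beta : I) (ab : (alpha < beta)%O), X alpha -> X beta ->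
      hom_injective (dirsum K C) (ds_map M (ltW ab)).
Proof.
split=> [M_ext_theta|[X [X_club X_inj]]]; last first.
  exact: (club_hom_injective_Ext1 I_wo theta_reg M_cont M_lim X_club M_ext X_inj).
have theta0 := below_neq0 theta_reg.
have /(inj_card_leP _ theta0)[e _ e_inj] := theta_le_K.
have [X [X_club X_inj]] := Ext1_club_hom_injective I_wo theta_reg M_cont M_lim
  e_inj M_gen M_ext M_ext_theta.
exists X; split=> // a b ab Xa Xb f; have [[Xt _] _] := X_club.
have [g gE] := X_inj a Xa b ab (Xt b Xb) f.
by exists g => x; rewrite -gE -transE.
Qed.
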